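(* Let $Y=(Y_1,\dots,Y_m)$ be a random vector with independent nonnegative coordinates, and let $f$ be a normalized, monotone, symmetric norm on $\mathbb{R}^m$. Let $\{\bar t_\ell\}_{\ell\in\mathrm{POS}_m}$ be a nonnegative, non-increasing sequence and $t'\in\mathbb{R}^m$ its expansion. (a) Suppose $\tau_{\beta\ell}(Y)\le\alpha\bar t_\ell$ for all $\ell\in\mathrm{POS}_m$, where $\alpha,\beta\ge1$. Then $\mathbb{E}[f(Y)]\le 2\cdot 7\cdot(\alpha+2)\beta\cdot\bigl(\sum_{i=1}^m\mathbb{E}[(Y_i-\alpha\bar t_1)^+]+f(t')\bigr)$. (b) Suppose $\tau_\ell(Y)\le\bar t_\ell\le 2\tau_\ell(Y)+\kappa$ for all $\ell\in\mathrm{POS}_m$, where $\kappa\ge0$. Then $\sum_{i=1}^m\mathbb{E}[(Y_i-\bar t_1)^+]+f(t')\le 32\,\mathbb{E}[f(Y)]+m\kappa$.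
   Context: $f$ is normalized if $f(1,0,\dots,0)=1$; monotone means $f(x)\le f(y)$ for $0\le x\le y$; symmetric means $f(x)=f(x^\downarrow)$ for $x\ge0$. $\mathrm{POS}_m=\{2^i:i\in\mathbb{Z}_{\ge0},2^i\le m\}$. The expansion of a sequence $\{v_\ell\}_{\ell\in\mathrm{POS}_m}$ is the vector $v'\in\mathbb{R}^m$ with $v'_i:=v_{2^{\lfloor\log_2 i\rfloor}}$. For $\theta\ge0$, $N^{>\theta}(Y)$ is the number of coordinates with $Y_i>\theta$; for a positive real $r$, $\tau_r(Y):=\inf\{\theta\ge0:\mathbb{E}[N^{>\theta}(Y)]<r\}$, with $\tau_r(Y):=0$ for $r>m$. $x^+=\max\{x,0\}$. *)

(* Defs.v *)
From HB Require Import structures.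
From mathcomp Require Import all_boot all_order all_algebra.
From mathcomp Require Import all_classical all_reals all_analysis.

Set Implicit Arguments.
Unset Strict Implicit.
Unset Printing Implicit Defensive.

Import Order.TTheory GRing.Theory Num.Theory.
Import numFieldNormedType.Exports.

Local Open Scope classical_set_scope.
Local Open Scope ring_scope.

Section Norms.
Context (R : realType) (m : nat).
Implicit Types (f : 'rV[R]_m -> R) (x y : 'rV[R]_m).

Definition is_norm f : Prop :=
  [/\ forall x y, f (x + y) <= f x + f y,
      forall (a : R) x, f (a *: x) = `|a| * f x
    & forall x, f x = 0 -> x = 0].

(* The argument is the row (1, 0, ..., 0).  When m = 0 it is the zero vector,
   so a normalized norm can only exist when 0 < m. *)
Definition normalized f : Prop := f (\row_(j < m) ((j : nat) == 0%N)%:R) = 1.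

Definition monotone_on_nonneg f : Prop :=
  forall x y, (forall i, 0 <= x 0 i) -> (forall i, x 0 i <= y 0 i) ->
    f x <= f y.

Definition sort_down x : 'rV[R]_m :=
  \row_(i < m) nth 0 (sort (>=%O) [seq x 0 j | j <- enum 'I_m]) i.

Definition symmetric_on_nonneg f : Prop :=
  forall x, (forall i, 0 <= x 0 i) -> f x = f (sort_down x).

End Norms.

Definition POS (m : nat) : set nat :=
  [set l | (exists i : nat, l = (2 ^ i)%N) /\ (l <= m)%N].

(* A sequence indexed by POS m is a function on nat of which only the values
   on POS m matter.  Coordinates of rows are numbered from 0, so coordinate j
   here is the usual coordinate j.+1; trunc_log 2 is the floor of log_2. *)
Definition expansion (R : realType) (m : nat) (v : nat -> R) : 'rV[R]_m :=
  \row_(j < m) v (2 ^ trunc_log 2 j.+1)%N.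

Section RandomVectors.
Context (d : measure_display) (T : measurableType d) (R : realType)
  (P : probability T R) (m : nat).
Implicit Type Y : 'I_m -> {RV P >-> R}.

Definition mutually_independent Y : Prop :=
  forall (J : {set 'I_m}) (B : 'I_m -> set R),
    (forall i, measurable (B i)) ->
    P (\bigcap_(i in [set` J]) (Y i @^-1` B i)) =
      (\prod_(i in J) P (Y i @^-1` B i))%E.

Definition rvec Y (w : T) : 'rV[R]_m := \row_(i < m) Y i w.

Definition count_above Y (theta : R) (w : T) : nat :=
  #|[set i : 'I_m | theta < Y i w]%SET|.

Definition tau Y (r : R) : R :=
  if m%:R < r then 0
  else inf [set theta : R | 0 <= theta /\
              ('E_P[fun w => ((count_above Y theta w)%:R)%R] < r%:E)%E].

End RandomVectors.

(* Main.v *)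
(* Second moments suffice in place of Chernoff bounds: the number N of
   coordinates of Y above theta satisfies Var N <= E N =: mu(theta),
   and mu(tau_r) <= r <= mu(theta) for every theta < tau_r.  Norms are compared
   by counting: if x has at most K times as many coordinates above each
   threshold as y, then f x <= K f y.

   (a) Split Y into the excess over alpha t_1, whose norm is at most the sum of
   its coordinates, and the part truncated at alpha t_1.  With N_l the number of
   coordinates above alpha t_l, AM-GM gives N_l <= beta l W for all l at once,
   where W = 3/2 + sum_l (N_l - E N_l)^2 / (2 (beta l)^2) and E W <= 5/2.  The
   norm of the truncated part is at most 2 (beta W + 1) alpha f(t').

   (b) The excess over tau_1 costs at most 2 E f(Y), because at most one
   coordinate is expected to exceed tau_1.  For the expansion of tau, the event
   that at least l/2 coordinates exceed (4/5) tau_l has probability at least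
   1/2 for each l.  Masking each block of (4/5) tau' by its event yields a random
   vector whose norm is at most 4 f(Y), and Jensen's inequality for the finitely
   many masks gives f(tau') <= 10 E f(Y). *)
Require Import Defs.
From HB Require Import structures.
From mathcomp Require Import all_boot all_order all_algebra.
From mathcomp Require Import all_classical all_reals all_analysis.
From mathcomp Require Import measurable_realfun.
From mathcomp Require Import ring lra zify.

Set Implicit Arguments.
Unset Strict Implicit.
Unset Printing Implicit Defensive.

Import Order.TTheory GRing.Theory Num.Theory.
Import numFieldNormedType.Exports.

Local Open Scope classical_set_scope.
Local Open Scope ring_scope.

Lemma nth_sorted_gt (R : realType) (s : seq R) (i : nat) (theta : R) :
  sorted >=%O s -> (i < size s)%N ->
  (theta < nth 0 s i) = (i < count (fun x => theta < x)%R s)%N.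
Proof.
elim: s i => [//|x s IHs] i /= sx.
have xs : all (<= x) s by rewrite (order_path_min _ sx) //; exact: ge_trans.
have IH := IHs _ (path_sorted sx).
have [tx|xt] := ltP theta x.
  by case: i => [|i] //= si; rewrite add1n ltnS IH.
have c0 : count (fun x0 => theta < x0) s = 0%N.
  apply/eqP; rewrite eqn0Ngt -has_count -all_predC; apply/allP => y ys /=.
  by rewrite -leNgt (le_trans _ xt)//; move/allP: xs; exact.
rewrite c0 => si; apply/negbTE; rewrite -leNgt (le_trans _ xt)//.
by case: i si => [|i]//= si; move/allP: xs; apply; rewrite mem_nth.
Qed.

Definition nabove (R : realType) (m : nat) (x : 'rV[R]_m) (theta : R) : nat :=
  #|[set i : 'I_m | theta < x 0 i]%SET|.

Section SymmetricMonotoneNorm.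
Context (R : realType) (m : nat) (f : 'rV[R]_m -> R).
Hypotheses (fnorm : is_norm f) (fnormalized : normalized f)
  (fmono : monotone_on_nonneg f) (fsym : symmetric_on_nonneg f).
Implicit Types (x y : 'rV[R]_m) (theta : R).

Lemma sort_down_gt x theta i :
  (theta < sort_down x 0 i) = (i < nabove x theta)%N.
Proof.
rewrite mxE nth_sorted_gt; first last.
- by rewrite size_sort size_map size_enum_ord.
- exact/sort_sorted/ge_total.
rewrite count_sort count_map /nabove cardE -size_filter.
congr (_ < _)%N; apply: perm_size; apply: uniq_perm.
- exact/filter_uniq/enum_uniq.
- exact: enum_uniq.
- by move=> j; rewrite mem_filter !mem_enum !inE andbT.
Qed.

Lemma sort_down_ge0 x : (forall i, 0 <= x 0 i) -> forall i, 0 <= sort_down x 0 i.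
Proof.
move=> x0 i; rewrite mxE.
suff /allP : all (>= 0) (sort >=%O [seq x 0 j | j <- enum 'I_m]).
  by apply; rewrite mem_nth// size_sort size_map size_enum_ord.
by apply/allP => y; rewrite mem_sort => /mapP[j _ ->].
Qed.

Lemma norm_le_nabove x y : (forall i, 0 <= x 0 i) -> (forall i, 0 <= y 0 i) ->
  (forall theta, 0 <= theta -> (nabove x theta <= nabove y theta)%N) ->
  f x <= f y.
Proof.
move=> x0 y0 xy; rewrite (fsym x0) (fsym y0).
apply: fmono => [|i]; first exact: sort_down_ge0.
rewrite leNgt; apply/negP => yx.
have := yx; rewrite sort_down_gt => /leq_trans/(_ (xy _ (sort_down_ge0 y0 i))).
by rewrite -sort_down_gt ltxx.
Qed.

Lemma norm0 : f 0 = 0.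
Proof. by case: fnorm => _ /(_ 0 0) + _; rewrite scale0r normr0 mul0r. Qed.

Lemma norm_sum (I : Type) (s : seq I) (Q : pred I) (F : I -> 'rV[R]_m) :
  f (\sum_(i <- s | Q i) F i) <= \sum_(i <- s | Q i) f (F i).
Proof.
case: fnorm => fD _ _.
elim/big_ind2: _ => [|x1 x2 y1 y2 h1 h2|//]; first by rewrite norm0.
by rewrite (le_trans (fD _ _))// lerD.
Qed.

Lemma normZ (a : R) x : 0 <= a -> f (a *: x) = a * f x.
Proof. by move=> a0; case: fnorm => _ -> _; rewrite ger0_norm. Qed.

Lemma norm_ge0 x : (forall i, 0 <= x 0 i) -> 0 <= f x.
Proof.
move=> x0; rewrite -norm0; apply: fmono => [i|i]; rewrite mxE //.
Qed.

(* The decreasing rearrangement of x is split into K vectors according to the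
   index modulo K; each of them has at most as many coordinates above theta
   as y. *)
Lemma norm_le_mul_nabove (K : nat) x y : (0 < K)%N ->
  (forall i, 0 <= x 0 i) -> (forall i, 0 <= y 0 i) ->
  (forall theta, 0 <= theta -> (nabove x theta <= K * nabove y theta)%N) ->
  f x <= K%:R * f y.
Proof.
move=> K0 x0 y0 xy; rewrite (fsym x0).
have sx0 := sort_down_ge0 x0.
pose z (r : 'I_K) : 'rV[R]_m :=
  \row_j (if (j %% K == r)%N then sort_down x 0 j else 0).
have -> : sort_down x = \sum_r z r.
  apply/rowP => j; rewrite summxE.
  rewrite (bigD1 (Ordinal (ltn_pmod j K0)))//= [in RHS]mxE eqxx big1 ?addr0//.
  move=> r rj; rewrite mxE; case: eqP => // jr; case/eqP: rj.
  by apply/val_inj; rewrite /= jr.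
apply: (le_trans (norm_sum _ _ _)).
rewrite -[K in K%:R]card_ord mulr_natl -sumr_const; apply: ler_sum => r _.
apply: norm_le_nabove => // [j|theta theta0].
  by rewrite mxE; case: ifP.
have zN j : j \in [set j | theta < z r 0 j]%SET ->
    (j %% K = r)%N /\ (j %/ K < nabove y theta)%N.
  rewrite inE mxE; case: eqP => [jr|_]; last by rewrite ltNge theta0.
  rewrite sort_down_gt => jx; split => //.
  by rewrite ltn_divLR// mulnC (leq_trans jx)// xy.
rewrite {1}/nabove cardE -(size_map (fun j : 'I_m => (j %/ K)%N)).
rewrite -[leqRHS](size_iota 0); apply: uniq_leq_size.
  rewrite map_inj_in_uniq ?enum_uniq// => j k.
  rewrite !mem_enum => /zN[jr _] /zN[kr _] jk.
  by apply/val_inj; rewrite /= (divn_eq j K) (divn_eq k K) jk jr kr.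
move=> _ /mapP[j + ->]; rewrite mem_enum => /zN[_ jN].
by rewrite mem_iota.
Qed.

Lemma norm_unit_row i : f (\row_j (j == i)%:R) = 1.
Proof.
rewrite -[RHS]fnormalized.
have m0 : (0 < m)%N by exact: leq_ltn_trans (leq0n i) (ltn_ord i).
have e0 (k : 'I_m) j : 0 <= (\row_j (j == k)%:R : 'rV[R]_m) 0 j by rewrite mxE.
have ek (k : 'I_m) theta : 0 <= theta ->
    nabove (\row_j (j == k)%:R) theta = (theta < 1)%R.
  move=> theta0; rewrite /nabove; case: ltP => theta1; last first.
    apply/eqP; rewrite cards_eq0; apply/eqP/setP => j; rewrite !inE mxE.
    by apply/negbTE; rewrite -leNgt; case: eqP.
  transitivity #|[set k]%SET|; last by rewrite cards1.
  apply: eq_card => j; rewrite !inE mxE.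
  by case: eqP => // _; rewrite ltNge theta0.
have -> : (\row_(j < m) ((j : nat) == 0%N)%:R)
    = \row_j (j == Ordinal m0)%:R :> 'rV[R]_m by apply/rowP => j; rewrite !mxE.
by apply/eqP; rewrite eq_le; apply/andP; split; apply: norm_le_nabove => // theta t0;
  rewrite !ek.
Qed.

Lemma norm_le_sum x : (forall i, 0 <= x 0 i) -> f x <= \sum_i x 0 i.
Proof.
move=> x0; have {1}-> : x = \sum_i x 0 i *: (\row_j (j == i)%:R).
  apply/rowP => j; rewrite summxE (bigD1 j)//= big1 => [|k /negbTE kj].
    by rewrite !mxE eqxx mulr1 addr0.
  by rewrite !mxE eq_sym kj mulr0.
apply: (le_trans (norm_sum _ _ _)); apply: ler_sum => i _.
by rewrite normZ// norm_unit_row mulr1.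
Qed.

Lemma coord_le_norm x i : (forall i, 0 <= x 0 i) -> x 0 i <= f x.
Proof.
move=> x0; rewrite -[leLHS]mulr1 -(norm_unit_row i) -normZ//.
apply: fmono => j; rewrite !mxE; first by rewrite mulr_ge0.
by case: eqP => [->|_]; rewrite ?mulr1 ?mulr0.
Qed.

End SymmetricMonotoneNorm.

Lemma POS_floor_pow2 (m : nat) (j : 'I_m) : POS m (2 ^ trunc_log 2 j.+1)%N.
Proof.
split; first by exists (trunc_log 2 j.+1).
by rewrite (leq_trans _ (ltn_ord j))// (@trunc_logP 2 j.+1).
Qed.

Lemma nabove_nonincr (R : realType) (m : nat) (x : 'rV[R]_m) (a b : R) :
  a <= b -> (nabove x b <= nabove x a)%N.
Proof.
move=> ab; apply/subset_leq_card/fintype.subsetP => i; rewrite !inE.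
exact: le_lt_trans.
Qed.

Lemma norm_le_expansion (R : realType) (m : nat) (f : 'rV[R]_m -> R) :
  is_norm f -> monotone_on_nonneg f -> symmetric_on_nonneg f ->
  forall (K : nat) (v : nat -> R) (x : 'rV[R]_m), (0 < K)%N ->
  (forall l, POS m l -> 0 <= v l) -> (forall i, 0 <= x 0 i <= v 1%N) ->
  (forall l, POS m l -> (nabove x (v l) <= K * l)%N) ->
  f x <= (2 * K)%:R * f (expansion m v).
Proof.
move=> fnorm fmono fsym K v x K0 v0 x0v xK.
apply: norm_le_mul_nabove => //; first by rewrite muln_gt0.
- by move=> i; case/andP: (x0v i).
- by move=> i; rewrite mxE v0//; exact: POS_floor_pow2.
move=> theta theta0; set n := nabove (expansion m v) theta.
have [mn|nm] := leqP m n.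
  rewrite (leq_trans (max_card _))// card_ord (leq_trans mn)// leq_pmull//.
  by rewrite muln_gt0.
have [j jn jtheta] : exists2 j : 'I_m, (j <= n)%N & expansion m v 0 j <= theta.
  apply: contrapT => /forall2NP nj.
  have : (#|'I_n.+1| <= n)%N.
    have widen_inj : injective (widen_ord nm) by move=> a b [/val_inj].
    rewrite -(card_imset _ widen_inj).
    apply/subset_leq_card/fintype.subsetP => _ /imsetP[k _ ->]; rewrite inE ltNge.
    by have [/=|/negP//] := nj (widen_ord nm k); rewrite -ltnS ltn_ord.
  by rewrite card_ord ltnn.
have [n0|n0] := posnP n.
  rewrite n0 muln0 leqn0 cards_eq0; apply/eqP/setP => i; rewrite !inE.
  apply/negbTE; rewrite -leNgt; case/andP: (x0v i) => _ /le_trans; apply.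
  apply: le_trans jtheta; rewrite mxE.
  by move: jn; rewrite n0 leqn0 => /eqP ->; rewrite trunc_log1.
move: jtheta; rewrite mxE; set l := (2 ^ _)%N => ltheta.
have lj : (l <= j.+1)%N by rewrite (@trunc_logP 2 j.+1).
rewrite (leq_trans (nabove_nonincr _ ltheta))//.
rewrite (leq_trans (xK l _))//; first exact: POS_floor_pow2.
by rewrite -mulnA mulnCA leq_mul2l; apply/orP; right; lia.
Qed.

Lemma masked_expansion_le_norm (R : realType) (m : nat) (f : 'rV[R]_m -> R) :
  is_norm f -> monotone_on_nonneg f -> symmetric_on_nonneg f ->
  forall (G : pred 'I_m) (v : nat -> R) (y : 'rV[R]_m),
  (forall l, POS m l -> 0 <= v l) -> (forall i, 0 <= y 0 i) ->
  (forall j, G j -> let l := (2 ^ trunc_log 2 j.+1)%N in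
    (l <= 2 * nabove y (v l))%N) ->
  f (\row_j (if G j then expansion m v 0 j else 0)) <= 4 * f y.
Proof.
move=> fnorm fmono fsym G v y v0 y0 yG.
apply: (@norm_le_mul_nabove _ _ _ _ _ _ 4) => //.
  by move=> j; rewrite mxE; case: ifP => // _; rewrite mxE v0//; exact: POS_floor_pow2.
move=> theta theta0; rewrite {1}/nabove; set S := [set j | _]%SET.
have [S0|[k kS]] := set_0Vmem S; first by rewrite S0 cards0.
have [j jS jmax] := arg_maxnP (fun j : 'I_m => j : nat) kS.
have : (#|S| <= j.+1)%N.
  rewrite cardE -(size_map (@nat_of_ord m)) -[leqRHS](size_iota 0).
  apply: uniq_leq_size; first by rewrite (map_inj_uniq val_inj) enum_uniq.
  move=> _ /mapP[i + ->]; rewrite mem_enum => /jmax ij.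
  by rewrite mem_iota.
have : (j.+1 < 2 ^ (trunc_log 2 j.+1).+1)%N by exact: trunc_log_ltn.
have := jS : j \in S; rewrite inE !mxE.
case: ifP => [Gj thetav|_]; last by rewrite ltNge theta0.
have := yG _ Gj; rewrite /= expnS; set l := (2 ^ _)%N => lN jl Sj.
have := nabove_nonincr y (ltW thetav); move: lN; rewrite -/l => lN Nl.
lia.
Qed.

Section ExpectationOfNonnegative.
Context (d : measure_display) (T : measurableType d) (R : realType)
  (P : probability T R).
Local Open Scope ereal_scope.

(* Neither function has to be measurable: the integral of a nonnegative
   function is a supremum over the simple functions below it. *)
Lemma ge0_expectation_le (X Z : T -> R) : (forall w, 0 <= X w)%R ->
  (forall w, X w <= Z w)%R -> 'E_P[X] <= 'E_P[Z].
Proof.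
move=> X0 XZ; rewrite unlock !ge0_integralTE; first last.
- by move=> w; rewrite lee_fin.
- by move=> w; rewrite lee_fin (le_trans (X0 w)).
apply: le_ereal_sup => _ [h hX <-]; exists h => //= w.
by rewrite (le_trans (hX w))// lee_fin.
Qed.

Lemma ge0_expectationD (X Z : T -> R) : (forall w, 0 <= X w)%R ->
  (forall w, 0 <= Z w)%R -> measurable_fun setT X -> measurable_fun setT Z ->
  'E_P[fun w => (X w + Z w)%R] = 'E_P[X] + 'E_P[Z].
Proof.
move=> X0 Z0 mX mZ; rewrite unlock -ge0_integralD//.
- by move=> w _; rewrite lee_fin.
- exact/measurable_EFinP.
- by move=> w _; rewrite lee_fin.
- exact/measurable_EFinP.
Qed.

Lemma ge0_expectationZl (k : R) (X : T -> R) : (0 <= k)%R ->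
  (forall w, 0 <= X w)%R -> measurable_fun setT X ->
  'E_P[fun w => (k * X w)%R] = k%:E * 'E_P[X].
Proof.
move=> k0 X0 mX; rewrite unlock -ge0_integralZl_EFin//.
- by move=> w _; rewrite lee_fin.
- exact/measurable_EFinP.
Qed.

Lemma ge0_expectation_sum (I : Type) (s : seq I) (X : I -> T -> R) :
  (forall i w, 0 <= X i w)%R -> (forall i, measurable_fun setT (X i)) ->
  'E_P[fun w => (\sum_(i <- s) X i w)%R] = \sum_(i <- s) 'E_P[X i].
Proof.
move=> X0 mX; elim: s => [|i s IHs].
  under [X in 'E_P[X]]funext do rewrite big_nil.
  by rewrite big_nil expectation_cst.
rewrite big_cons; under [X in 'E_P[X]]funext do rewrite big_cons.
rewrite ge0_expectationD ?IHs//.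
- by move=> w; exact: sumr_ge0.
- exact: measurable_sum.
Qed.

(* Given {Z \in B}, independence leaves the law of X unchanged up to the factor
   P(Z \in B). *)
Lemma expectation_comp_mul_indic (X Z : {RV P >-> R}) (g : R -> R) (B : set R) :
  measurable B -> measurable_fun setT g -> (forall x, 0 <= g x)%R ->
  (forall A, measurable A ->
    P (X @^-1` A `&` Z @^-1` B) = P (X @^-1` A) * P (Z @^-1` B)) ->
  'E_P[fun w => (g (X w) * \1_(Z @^-1` B) w)%R] =
    P (Z @^-1` B) * 'E_P[fun w => g (X w)].
Proof.
move=> mB mg g0 XZ.
have mZB : measurable (Z @^-1` B) by rewrite -[_ @^-1` _]setTI; exact: measurable_funP.
pose V w : R := (g (X w) * \1_(Z @^-1` B) w)%R.
have mgX : measurable_fun setT (g \o X) by exact: measurableT_comp.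
have mV : measurable_fun setT V by exact: measurable_funM.
pose gX' : {RV P >-> R} := HB.pack (g \o X) (isMeasurableFun.Build _ _ _ _ _ mgX).
pose V' : {RV P >-> R} := HB.pack V (isMeasurableFun.Build _ _ _ _ _ mV).
rewrite (ge0_expectation_ccdf (X := V')); last by move=> w; rewrite mulr_ge0.
rewrite (ge0_expectation_ccdf (X := gX')); last by move=> w; exact: g0.
rewrite -ge0_integralZl//; last first.
  by apply: measurable_funTS; exact: ccdf_measurable.
apply: eq_integral => r; rewrite inE/= in_itv/= andbT => r0.
rewrite muleC /ccdf /distribution /pushforward /=.
have -> : V @^-1` `]r, +oo[ = X @^-1` (g @^-1` `]r, +oo[) `&` Z @^-1` B.
  apply/seteqP; split => w /=; rewrite /V indicE !in_itv/= !andbT.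
    case: (boolP (w \in _)) => [|_]; first by rewrite inE mulr1.
    by rewrite mulr0 ltNge r0.
  by move=> [rg ZB]; rewrite mem_set// mulr1.
by rewrite XZ// -[_ @^-1` _]setTI; exact: mg.
Qed.

End ExpectationOfNonnegative.

Section CountAbove.
Context (d : measure_display) (T : measurableType d) (R : realType)
  (P : probability T R) (m : nat) (Y : 'I_m -> {RV P >-> R}).
Hypothesis Yindep : mutually_independent Y.
Implicit Types (theta r c : R).

Lemma independent_pair i j A B : i != j -> measurable A -> measurable B ->
  (P (Y i @^-1` A `&` Y j @^-1` B) = P (Y i @^-1` A) * P (Y j @^-1` B))%E.
Proof.
move=> ij mA mB.
have := @Yindep [set i; j]%SET (fun k => if k == i then A else B).
rewrite big_setU1 ?inE//= big_set1 eqxx [j == i]eq_sym (negbTE ij) => <-.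
  congr (P _); apply/seteqP; split => w /=.
    by move=> [Aw Bw] k /=; rewrite !inE => /orP[|] /eqP ->;
      rewrite ?eqxx// eq_sym (negbTE ij).
  move=> h; split; first by have := h i; rewrite /= !inE eqxx; exact.
  have := h j; rewrite /= !inE eqxx orbT [j == i]eq_sym (negbTE ij); exact.
by move=> k; case: ifP.
Qed.

Lemma count_above_nabove theta w :
  count_above Y theta w = nabove (rvec Y w) theta.
Proof. by apply: eq_card => i; rewrite !inE mxE. Qed.

Lemma count_aboveE theta w :
  (count_above Y theta w)%:R = \sum_i \1_(Y i @^-1` `]theta, +oo[) w :> R.
Proof.
rewrite /count_above -sum1_card natr_sum [LHS]big_mkcond/=.
apply: eq_bigr => i _; rewrite inE indicE; case: ifP => h.
  by rewrite mem_set//= in_itv/= h.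
by rewrite memNset//= in_itv/= h.
Qed.

Lemma measurable_above i theta : measurable (Y i @^-1` `]theta, +oo[).
Proof. by rewrite -[_ @^-1` _]setTI; exact: measurable_funP. Qed.

Lemma measurable_count_above theta :
  measurable_fun setT (fun w => (count_above Y theta w)%:R : R).
Proof.
under eq_fun do rewrite count_aboveE.
by apply: measurable_sum => i; exact/measurable_indic/measurable_above.
Qed.

Lemma measurable_count_above_ge theta (k l : nat) : (0 < k)%N ->
  measurable [set w | (l <= k * count_above Y theta w)%N].
Proof.
move=> k0; have k0R : 0 < k%:R :> R by rewrite ltr0n.
have -> : [set w | (l <= k * count_above Y theta w)%N] =
    setT `&` (fun w => (count_above Y theta w)%:R : R) @^-1` `[l%:R / k%:R, +oo[.
  rewrite setTI; apply/seteqP; split => w; rewrite /= in_itv/= andbT.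
    by rewrite -(ler_nat R) natrM ler_pdivrMr// mulrC.
  by rewrite -(ler_nat R) natrM ler_pdivrMr// mulrC.
exact: measurable_count_above.
Qed.

Definition mean_above theta : R := \sum_i fine (ccdf (Y i) theta).

Lemma ccdf_fineK i theta : (fine (ccdf (Y i) theta))%:E = ccdf (Y i) theta.
Proof. by rewrite fineK// fin_num_measure//; exact: measurable_itv. Qed.

Lemma ccdf_fine_ge0 i theta : 0 <= fine (ccdf (Y i) theta).
Proof. by rewrite fine_ge0. Qed.

Lemma mean_above_ge0 theta : 0 <= mean_above theta.
Proof. by apply: sumr_ge0 => i _; exact: ccdf_fine_ge0. Qed.

Lemma expectation_count_above theta :
  ('E_P[fun w => (count_above Y theta w)%:R%R] = (mean_above theta)%:E)%E.
Proof.
under [X in ('E_P[X])%E]funext do rewrite count_aboveE.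
rewrite ge0_expectation_sum// => [|i]; last exact/measurable_indic/measurable_above.
rewrite /mean_above -sumEFin; apply: eq_bigr => i _.
by rewrite expectation_indic ?ccdf_fineK//; exact: measurable_above.
Qed.

Lemma expectation_count_above_sqr theta :
  ('E_P[fun w => ((count_above Y theta w)%:R ^+ 2)%R] <=
    ((mean_above theta + mean_above theta ^+ 2)%R)%:E)%E.
Proof.
set A := fun i => Y i @^-1` `]theta, +oo[.
have mA i : measurable (A i) by exact: measurable_above.
have -> : (fun w => (count_above Y theta w)%:R ^+ 2) =
    (fun w => \sum_i \sum_j \1_(A i `&` A j) w) :> (T -> R).
  apply/funext => w; rewrite count_aboveE expr2 big_distrlr /=.
  by apply: eq_bigr => i _; apply: eq_bigr => j _; rewrite indicI.
have mAA i j : measurable_fun setT (\1_(A i `&` A j) : T -> R).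
  exact/measurable_indic/measurableI.
rewrite ge0_expectation_sum; first last.
- by move=> i; apply: measurable_sum => j.
- by move=> i w; apply: sumr_ge0.
have -> : mean_above theta + mean_above theta ^+ 2 = \sum_i \sum_j
    (fine (ccdf (Y i) theta) * (j == i)%:R
      + fine (ccdf (Y i) theta) * fine (ccdf (Y j) theta)).
  rewrite expr2 {2 3}/mean_above big_distrlr -big_split /=.
  apply: eq_bigr => i _; rewrite big_split /=; congr (_ + _).
  rewrite (bigD1 i)//= eqxx mulr1 big1 ?addr0// => j /negbTE ->.
  by rewrite mulr0.
rewrite -sumEFin; apply: lee_sum => i _.
rewrite ge0_expectation_sum// -sumEFin; apply: lee_sum => j _.
rewrite expectation_indic; last exact: measurableI.
have [->|ji] := eqVneq j i.
  rewrite setIid mulr1 EFinD ccdf_fineK leeDl// lee_fin.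
  by rewrite mulr_ge0// ccdf_fine_ge0.
by rewrite mulr0 add0r EFinM !ccdf_fineK independent_pair// eq_sym.
Qed.

Lemma expectation_count_above_dev theta c : 0 <= c ->
  ('E_P[fun w => (((count_above Y theta w)%:R - c) ^+ 2)%R] <=
    (mean_above theta + (mean_above theta - c) ^+ 2)%:E)%E.
Proof.
move=> c0; set mu := mean_above theta.
pose N w : R := (count_above Y theta w)%:R.
have mN : measurable_fun setT N by exact: measurable_count_above.
have mN2 : measurable_fun setT (fun w => N w ^+ 2) by exact: measurable_funX.
have mD : measurable_fun setT (fun w => (N w - c) ^+ 2).
  by apply: measurable_funX; exact: measurable_funB.
have eN : ('E_P[fun w => ((N w - c) ^+ 2)%R] + (2 * c * mu)%:E =
    'E_P[fun w => (N w ^+ 2)%R] + (c ^+ 2)%:E)%E.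
  rewrite [in LHS]EFinM -expectation_count_above -ge0_expectationZl//;
    last by rewrite mulr_ge0.
  rewrite -(expectation_cst P (c ^+ 2)) -!ge0_expectationD//.
  - by congr ('E_P[_])%E; apply/funext => w; rewrite /N /=; ring.
  - by move=> w; exact: sqr_ge0.
  - by move=> w; exact: sqr_ge0.
  - by move=> w; exact: sqr_ge0.
  - by move=> w; rewrite !mulr_ge0.
  - exact: measurable_funM.
rewrite -(@leeD2rE _ (2 * c * mu)%:E)// eN.
apply: (le_trans (leeD2r _ (expectation_count_above_sqr theta))).
by rewrite -!EFinD lee_fin le_eqVlt; apply/orP; left; apply/eqP; rewrite -/mu; ring.
Qed.

End CountAbove.

Section Tau.
Context (d : measure_display) (T : measurableType d) (R : realType)
  (P : probability T R) (m : nat) (Y : 'I_m -> {RV P >-> R}).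
Implicit Types (theta r : R).

Lemma mean_above_nonincr theta theta' : theta <= theta' ->
  mean_above Y theta' <= mean_above Y theta.
Proof.
move=> tt'; apply: ler_sum => i _.
by rewrite -lee_fin !ccdf_fineK ccdf_nonincreasing.
Qed.

Lemma mean_above_le theta : mean_above Y theta <= m%:R.
Proof.
rewrite -[m in leRHS]card_ord -sumr_const; apply: ler_sum => i _.
by rewrite -lee_fin ccdf_fineK probability_le1//; exact: measurable_above.
Qed.

Lemma mean_above_right_continuous : right_continuous (mean_above Y).
Proof.
move=> theta; apply: cvg_big => [|i _]; [exact: add_continuous|];
 apply: fine_cvg.
by rewrite ccdf_fineK; exact: ccdf_right_continuous.
Qed.

Lemma cvg_mean_abovey0 : mean_above Y @ +oo --> (0 : R).
Proof.
rewrite [X in _ --> X](_ : _ = \sum_(i < m) 0); last by rewrite big1.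
apply: cvg_big => [|i _]; [exact: add_continuous|];
 apply: fine_cvg; exact: cvg_ccdfy0.
Qed.

Definition below_level r : set R :=
  [set theta | 0 <= theta /\ mean_above Y theta < r].

Lemma tauE r : r <= m%:R -> tau Y r = inf (below_level r).
Proof.
move=> rm; rewrite /tau ltNge rm /=; congr (inf _).
by apply/seteqP; split => theta /= [h]; rewrite expectation_count_above lte_fin.
Qed.

Lemma below_level_has_inf r : 0 < r -> has_inf (below_level r).
Proof.
move=> r0; split; last by exists 0 => theta [].
have : \forall theta \near +oo, 0 <= theta /\ mean_above Y theta < r.
  near=> theta; split; first by near: theta; exact: nbhs_pinfty_ge.
  by near: theta; move/cvgr_lt : cvg_mean_abovey0; apply.
by move=> /filter_ex[theta h]; exists theta.
Unshelve. all: by end_near. Qed.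

Lemma tau_ge0 r : 0 < r -> 0 <= tau Y r.
Proof.
move=> r0; have [mr|rm] := ltP m%:R r; first by rewrite /tau mr.
rewrite tauE//; apply: lb_le_inf => [|theta []//].
exact: (below_level_has_inf r0).1.
Qed.

Lemma mean_above_tau r : 0 < r -> mean_above Y (tau Y r) <= r.
Proof.
move=> r0; have [mr|rm] := ltP m%:R r.
  exact: le_trans (mean_above_le _) (ltW mr).
apply: (cvgr_to_le (@mean_above_right_continuous (tau Y r))).
near=> theta.
have tautheta : tau Y r < theta by near: theta; exact: nbhs_right_gt.
have [s [_ sr] stheta] : exists2 s, below_level r s & s < theta.
  by apply: inf_lt; [exact: (below_level_has_inf r0).1|rewrite -tauE].
exact: ltW (le_lt_trans (mean_above_nonincr (ltW stheta)) sr).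
Unshelve. all: by end_near. Qed.

Lemma mean_above_lt_tau theta r : 0 < r -> r <= m%:R ->
  0 <= theta -> theta < tau Y r -> r <= mean_above Y theta.
Proof.
move=> r0 rm theta0; rewrite tauE// ltNge; apply: contraNT; rewrite -ltNge => h.
by apply: ge_inf => //; exact: (below_level_has_inf r0).2.
Qed.

End Tau.


Section Jensen.
Context (d : measure_display) (T : measurableType d) (R : realType)
  (P : probability T R) (m : nat) (f : 'rV[R]_m -> R).
Hypotheses (fnorm : is_norm f) (fmono : monotone_on_nonneg f).

Let mask (x : 'rV[R]_m) (Q : pred 'I_m) : 'rV[R]_m :=
  \row_j (if Q j then x 0 j else 0).

Lemma norm_mask_expectation (G : 'I_m -> set T) (x : 'rV[R]_m) :
  (forall j, measurable (G j)) -> (forall j, 0 <= x 0 j) ->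
  ((f (\row_j (fine (P (G j)) * x 0 j)))%R%:E <=
    'E_P[fun w => (f (\row_j (if w \in G j then x 0 j else 0)))%R])%E.
Proof.
move=> mG x0.
pose pat w : {set 'I_m} := [set j | w \in G j]%SET.
pose A (S : {set 'I_m}) : set T := [set w | pat w = S].
have mA S : measurable (A S).
  have -> : A S = \bigcap_(j in setT) (if j \in S then G j else ~` G j).
    apply/seteqP; split => w.
      move=> <- j _; rewrite inE; case: ifPn; first by rewrite inE.
      by rewrite notin_setE.
    move=> h; apply/setP => j; rewrite inE; have := h j I.
    by case: ifP => _ Gw; [rewrite mem_set|rewrite memNset].
  apply: fin_bigcap_measurable => [|j _]; first exact: finite_finset.
  by case: ifP => // _; exact: measurableC.
have PA S : ((fine (P (A S)))%:E = P (A S))%E by rewrite fineK// fin_num_measure.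
have indicA (g : {set 'I_m} -> R) w : g (pat w) = \sum_S g S * \1_(A S) w.
  rewrite (bigD1 (pat w))//= indicE mem_set// mulr1 big1 ?addr0// => S Sw.
  by rewrite indicE memNset ?mulr0// => wS; rewrite wS eqxx in Sw.
have EA (g : {set 'I_m} -> R) : (forall S, 0 <= g S) ->
    ('E_P[fun w => g (pat w)] = (\sum_S g S * fine (P (A S)))%R%:E)%E.
  move=> g0; under [X in ('E_P[X])%E]funext do rewrite indicA.
  rewrite ge0_expectation_sum => [|S w|S]; first last.
  - by apply: measurable_funM => //; exact/measurable_indic.
  - by rewrite mulr_ge0.
  rewrite -sumEFin; apply: eq_bigr => S _.
  by rewrite ge0_expectationZl// expectation_indic// EFinM PA.
have -> : (fun w => f (\row_j (if w \in G j then x 0 j else 0))) =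
    (fun w => f (mask x (fun j => j \in pat w))).
  by apply/funext => w; congr f; apply/rowP => j; rewrite !mxE finset.in_set.
rewrite (EA (fun S => f (mask x (fun j => j \in S)))); last first.
  by move=> S; apply: norm_ge0 => // j; rewrite mxE; case: ifP.
have -> : \row_j (fine (P (G j)) * x 0 j) =
    \sum_S fine (P (A S)) *: mask x (fun j => j \in S).
  apply/rowP => j; rewrite mxE summxE.
  have -> : fine (P (G j)) = \sum_(S : {set 'I_m}) (j \in S)%:R * fine (P (A S)).
    apply: EFin_inj; rewrite -(EA (fun S : {set 'I_m} => (j \in S)%:R))//.
    rewrite fineK ?fin_num_measure//.
    rewrite -expectation_indic//; congr ('E_P[_])%E; apply/funext => w.
    by rewrite indicE finset.in_set.
  rewrite mulr_suml; apply: eq_bigr => S _; rewrite !mxE.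
  by case: ifP => _; rewrite ?mul1r ?mul0r ?mulr0.
rewrite lee_fin (le_trans (norm_sum fnorm _ _ _))//.
by apply: ler_sum => S _; rewrite normZ// 1?mulrC// fine_ge0.
Qed.

End Jensen.

Lemma le_nabove (R : realType) (m : nat) (x y : 'rV[R]_m) (theta : R) :
  (forall i, x 0 i <= y 0 i) -> (nabove x theta <= nabove y theta)%N.
Proof.
move=> xy; apply/subset_leq_card/fintype.subsetP => i; rewrite !inE => /lt_le_trans.
exact.
Qed.

Lemma sum_halves_le2 (R : realType) (n : nat) :
  \sum_(k < n) (2 ^+ k)^-1 <= 2 :> R.
Proof.
suff -> : \sum_(k < n) (2 ^+ k)^-1 = 2 - 2 * (2 ^+ n)^-1 :> R.
  by rewrite gerBl mulr_ge0// invr_ge0 exprn_ge0.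
elim: n => [|n IHn]; first by rewrite big_ord0 expr0 invr1 mulr1 subrr.
rewrite big_ord_recr /= IHn exprS.
have : 2 ^+ n != 0 :> R by rewrite expf_neq0.
by move=> h; field.
Qed.

Section NormOfIndependentVector.
Context (d : measure_display) (T : measurableType d) (R : realType)
  (P : probability T R) (m : nat) (Y : 'I_m -> {RV P >-> R}).
Hypotheses (Yindep : mutually_independent Y) (Yge0 : forall i w, 0 <= Y i w).
Context (f : 'rV[R]_m -> R).
Hypotheses (fnorm : is_norm f) (fnormalized : normalized f)
  (fmono : monotone_on_nonneg f) (fsym : symmetric_on_nonneg f).
Context (t : nat -> R).
Hypothesis tge0 : forall l, POS m l -> 0 <= t l.

Let rvec_ge0 w i : 0 <= rvec Y w 0 i. Proof. by rewrite mxE. Qed.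

Lemma dim_gt0 : (0 < m)%N.
Proof.
rewrite lt0n; apply/eqP => m0.
have e0 : \row_(j < m) ((j : nat) == 0%N)%:R = 0 :> 'rV[R]_m.
  by apply/rowP => j; exfalso; move: (ltn_ord j); rewrite [X in (_ < X)%N]m0.
by move: fnormalized; rewrite /normalized e0 norm0// => /esym/eqP; rewrite oner_eq0.
Qed.

Lemma POS1 : POS m 1%N.
Proof. by split; [exists 0%N|exact: dim_gt0]. Qed.

Lemma POS_gt0 l : POS m l -> (0 < l)%N.
Proof. by move=> [[k ->] _]; rewrite expn_gt0. Qed.

Section UpperBound.
Variables alpha beta : R.
Hypotheses (alpha1 : 1 <= alpha) (beta1 : 1 <= beta)
  (tau_le : forall l, POS m l -> tau Y (beta * l%:R) <= alpha * t l).

Let L := (trunc_log 2 m).+1.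
Let level k : R := alpha * t (2 ^ k)%N.
Let target k : R := beta * 2 ^+ k.
Let dev k w : R := ((count_above Y (level k) w)%:R - mean_above Y (level k)) ^+ 2.
Let excess w : R := 3 / 2 + \sum_(k < L) dev k w / (2 * target k ^+ 2).

Let alpha0 : 0 <= alpha. Proof. exact: le_trans alpha1. Qed.
Let beta0 : 0 < beta. Proof. exact: lt_le_trans beta1. Qed.
Let target_gt0 k : 0 < target k. Proof. by rewrite mulr_gt0// exprn_gt0. Qed.

Lemma mean_above_level_le k : (k < L)%N -> mean_above Y (level k) <= target k.
Proof.
move=> kL.
have Pk : POS m (2 ^ k)%N.
  split; first by exists k.
  by rewrite (leq_trans _ (@trunc_logP 2 m _ dim_gt0))// leq_pexp2l.
have := tau_le Pk; rewrite natrX => /mean_above_nonincr/le_trans; apply.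
by apply: mean_above_tau; exact: target_gt0.
Qed.

Let dev_ge0 k w : 0 <= dev k w. Proof. exact: sqr_ge0. Qed.

Lemma count_above_level_le k w : (k < L)%N ->
  (count_above Y (level k) w)%:R <= target k * excess w.
Proof.
move=> kL; rewrite /excess (bigD1 (Ordinal kL))//= mulrDr mulrDr.
set S := \sum_(_ < _ | _) _.
have S0 : 0 <= target k * S.
  rewrite mulr_ge0//; first exact: ltW.
  apply: sumr_ge0 => i _.
  by rewrite divr_ge0// mulr_ge0// exprn_ge0// ltW.
have := mean_above_level_le kL; have b0 := target_gt0 k.
rewrite /dev; set N := _%:R; set mu := mean_above _ _; set b := target k in b0 S0 *.
have -> : b * ((N - mu) ^+ 2 / (2 * b ^+ 2)) = (N - mu) ^+ 2 / (2 * b).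
  by field; rewrite gt_eqF.
have : N - mu <= b / 2 + (N - mu) ^+ 2 / (2 * b).
  rewrite -subr_ge0 (_ : _ - _ = (N - mu - b) ^+ 2 / (2 * b)).
    by rewrite divr_ge0 ?sqr_ge0// mulr_ge0// ltW.
  by field; rewrite gt_eqF.
by move: S0; set q := _ / (2 * b); lra.
Qed.

Lemma norm_rvec_le w : f (rvec Y w) <=
  \sum_(i < m) Num.max (Y i w - alpha * t 1%N) 0
    + 2 * alpha * f (expansion m t) * (beta * excess w + 1).
Proof.
set c := alpha * t 1%N.
pose x : 'rV[R]_m := \row_i Num.min (Y i w) c.
pose z : 'rV[R]_m := \row_i Num.max (Y i w - c) 0.
have c0 : 0 <= c by rewrite mulr_ge0// tge0//; exact: POS1.
have -> : rvec Y w = z + x.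
  by apply/rowP => i; rewrite !mxE; case: (leP (Y i w) c) => ?;
    case: leP => ?; lra.
have [fD _ _] := fnorm; rewrite (le_trans (fD _ _))// lerD//.
  rewrite (le_trans (norm_le_sum fnorm fnormalized fmono fsym _))//.
    by move=> i; rewrite mxE le_max lexx orbT.
  by apply: ler_sum => i _; rewrite mxE.
have F0 : 0 <= f (expansion m t).
  by apply: norm_ge0 => // i; rewrite mxE tge0//; exact: POS_floor_pow2.
have W0 : 0 <= beta * excess w.
  rewrite mulr_ge0 ?(ltW beta0)// addr_ge0// sumr_ge0// => k _.
  by rewrite divr_ge0// mulr_ge0// exprn_ge0// ltW.
pose K := (Num.truncn (beta * excess w)).+1.
have KW : K%:R <= beta * excess w + 1.
  by rewrite -natr1 lerD2r truncn_le.
have WK : beta * excess w <= K%:R by rewrite ltW// truncnS_gt.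
have xK l : POS m l -> (nabove x (alpha * t l) <= K * l)%N.
  move=> [[k ->] km].
  have kL : (k < L)%N by rewrite ltnS trunc_log_max.
  rewrite -(ler_nat R) natrM natrX.
  apply: (@le_trans _ _ (count_above Y (level k) w)%:R).
    by rewrite ler_nat count_above_nabove le_nabove// => i; rewrite !mxE ge_min lexx.
  rewrite (le_trans (count_above_level_le _ kL))// /target mulrAC mulrC.
  by rewrite [leRHS]mulrC ler_wpM2l// exprn_ge0.
have := @norm_le_expansion _ _ _ fnorm fmono fsym K (fun l => alpha * t l) x.
move=> /(_ isT) /(_ _ _ xK) xle.
apply: (le_trans (xle _ _)) => [l Pl|i|].
- by rewrite mulr_ge0// tge0.
- by rewrite mxE le_min Yge0 c0 ge_min lexx orbT.
have -> : expansion m (fun l => alpha * t l) = alpha *: expansion m t.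
  by apply/rowP => i; rewrite !mxE.
rewrite normZ// natrM mulrA -[2 * _ * alpha]mulrA -[2 * alpha * _]mulrA.
by rewrite -!mulrA ler_wpM2l// mulrCA ler_wpM2l// mulrC ler_wpM2l.
Qed.

Lemma expectation_norm_le :
  ('E_P[fun w => f (rvec Y w)] <=
    \sum_(i < m) 'E_P[fun w => (Num.max (Y i w - alpha * t 1%N) 0)%R]
      + (7 * alpha * beta * f (expansion m t))%:E)%E.
Proof.
set F := f (expansion m t).
have F0 : 0 <= F.
  by apply: norm_ge0 => // i; rewrite mxE tge0//; exact: POS_floor_pow2.
pose c0 := 2 * alpha * F * (beta * (3 / 2) + 1).
pose c1 k := 2 * alpha * F * beta / (2 * target k ^+ 2).
have c00 : 0 <= c0 by rewrite !mulr_ge0// addr_ge0// mulr_ge0// ltW.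
have c10 k : 0 <= c1 k.
  by rewrite divr_ge0 ?mulr_ge0// ?(ltW beta0)// exprn_ge0// ltW.
have mdev k : measurable_fun setT (dev k).
  by apply: measurable_funX; apply: measurable_funB => //; exact: measurable_count_above.
have mmax i : measurable_fun setT (fun w => Num.max (Y i w - alpha * t 1%N) 0).
  by apply: measurable_maxr => //; exact: measurable_funB.
have max0 i w : 0 <= Num.max (Y i w - alpha * t 1%N) 0 by rewrite le_max lexx orbT.
have cdev0 k w : 0 <= c1 k * dev k w by rewrite mulr_ge0.
have mcdev k : measurable_fun setT (fun w => c1 k * dev k w).
  exact: measurable_funM.
apply: (@le_trans _ _ ('E_P[fun w =>
  (\sum_(i < m) Num.max (Y i w - alpha * t 1%N) 0
    + (c0 + \sum_(k < L) c1 k * dev k w))%R])%E).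
  apply: ge0_expectation_le => w; first exact: norm_ge0.
  rewrite (le_trans (norm_rvec_le w))// lerD2l le_eqVlt; apply/orP; left; apply/eqP.
  rewrite /excess -/F; set S := \sum_(_ < _) _.
  have -> : 2 * alpha * F * (beta * (3 / 2 + S) + 1) = c0 + 2 * alpha * F * beta * S.
    by rewrite /c0; ring.
  congr (_ + _); rewrite /S mulr_sumr.
  by apply: eq_bigr => k _; rewrite /c1 -/F; ring.
rewrite ge0_expectationD//; first last.
- by apply: measurable_funD => //; exact: measurable_sum.
- exact: measurable_sum.
- by move=> w; rewrite addr_ge0// sumr_ge0.
- by move=> w; rewrite sumr_ge0.
rewrite ge0_expectation_sum// leeD2l//.
rewrite (@ge0_expectationD _ _ _ P (fun=> c0))//; first last.
- exact: measurable_sum.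
- by move=> w; rewrite sumr_ge0.
rewrite (expectation_cst P c0) ge0_expectation_sum//.
have step k : (k < L)%N ->
    ('E_P[fun w => (c1 k * dev k w)%R] <= (alpha * F * (2 ^+ k)^-1)%:E)%E.
  move=> kL; rewrite ge0_expectationZl//.
  apply: (@le_trans _ _ ((c1 k)%:E * (target k)%:E)%E).
    rewrite lee_wpmul2l ?lee_fin//.
    rewrite (le_trans (expectation_count_above_dev Yindep _ (mean_above_ge0 _ _)))//.
    by rewrite subrr expr0n addr0 lee_fin mean_above_level_le.
  rewrite -EFinM lee_fin le_eqVlt; apply/orP; left; apply/eqP.
  rewrite /c1 /target; field.
  by rewrite (gt_eqF beta0) expf_neq0.
apply: (@le_trans _ _ (c0%:E + \sum_(k < L) (alpha * F * (2 ^+ k)^-1)%:E)%E).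
  by rewrite leeD2l// lee_sum// => k _; exact: step.
rewrite sumEFin -EFinD lee_fin -mulr_sumr.
have aF0 : 0 <= alpha * F by rewrite mulr_ge0.
apply: (@le_trans _ _ (c0 + alpha * F * 2)).
  by rewrite lerD2l ler_wpM2l// sum_halves_le2.
rewrite /c0 -/F.
have -> : 2 * alpha * F * (beta * (3 / 2) + 1) + alpha * F * 2 =
  alpha * F * (3 * beta + 4) by field.
have -> : 7 * alpha * beta * F = alpha * F * (7 * beta) by ring.
by rewrite ler_wpM2l//; move: beta1; lra.
Qed.

End UpperBound.

(* One-sided Chebyshev: measuring the squared deviation from mu + 1 brings the probability of the complement down to
   4 (mu + 1) / (mu + 3)^2 <= 1/2. *)
Lemma count_above_ge_half theta l : (0 < l)%N -> l%:R <= mean_above Y theta ->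
  2^-1 <= fine (P [set w | (l <= 2 * count_above Y theta w)%N]).
Proof.
move=> l0 lmu; set A := [set w | _]; set mu := mean_above Y theta in lmu *.
pose N w : R := (count_above Y theta w)%:R.
have mN : measurable_fun setT N by exact: measurable_count_above.
have mA : measurable A by exact: measurable_count_above_ge.
have l1 : 1 <= l%:R :> R by rewrite ler1n.
have mu3 : 0 < (mu + 3) ^+ 2 by rewrite exprn_gt0//; lra.
pose c := 4 / (mu + 3) ^+ 2.
have c0 : 0 <= c by rewrite divr_ge0// ltW.
have mD : measurable_fun setT (fun w => (N w - (mu + 1)) ^+ 2).
  by apply: measurable_funX; exact: measurable_funB.
have PAC : (P (~` A) <= (2^-1)%:E)%E.
  rewrite -expectation_indic; last exact: measurableC.
  apply: (@le_trans _ _ ('E_P[fun w => (c * (N w - (mu + 1)) ^+ 2)%R])%E).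
    apply: ge0_expectation_le => // w; rewrite indicE.
    case: (boolP (w \in _)) => [|_]; last by rewrite mulr_ge0// sqr_ge0.
    rewrite inE /A /= => /negP; rewrite -ltnNge => Nl.
    have : 2 * N w + 1 <= mu.
      rewrite (le_trans _ lmu)// /N -natrM natr1 ler_nat; exact: Nl.
    move=> Nmu; rewrite /c mulrAC ler_pdivlMr// mul1r -subr_ge0.
    rewrite (_ : _ - _ = (mu - 2 * N w - 1) * (3 * mu - 2 * N w + 5)); last by ring.
    have N0 : 0 <= N w by rewrite /N.
    by rewrite mulr_ge0//; lra.
  rewrite ge0_expectationZl//; last by move=> w; exact: sqr_ge0.
  apply: (@le_trans _ _ (c%:E * (mu + 1)%:E)%E).
    rewrite lee_wpmul2l ?lee_fin//.
    rewrite (le_trans (expectation_count_above_dev Yindep _ _))//; first by lra.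
    by rewrite lee_fin -/mu; lra.
  rewrite -EFinM lee_fin /c mulrAC ler_pdivrMr// -subr_ge0.
  rewrite (_ : _ - _ = 2^-1 * (mu - 1) ^+ 2); last by field.
  by rewrite mulr_ge0// sqr_ge0.
have := PAC; rewrite probability_setC// -[P A]fineK ?fin_num_measure//.
by rewrite -EFinB lee_fin; lra.
Qed.

Lemma norm_expansion_tau_le :
  ((f (expansion m (fun l => tau Y l%:R)))%:E <=
    10%:E * 'E_P[fun w => f (rvec Y w)])%E.
Proof.
set tau' := expansion _ _.
pose v (l : nat) : R := 4 / 5 * tau Y l%:R.
pose fl (j : 'I_m) : nat := (2 ^ trunc_log 2 j.+1)%N.
pose G j : set T := [set w | (fl j <= 2 * count_above Y (v (fl j)) w)%N].
have flP j : POS m (fl j) by exact: POS_floor_pow2.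
have fl0 j : 0 < (fl j)%:R :> R by rewrite ltr0n (POS_gt0 (flP j)).
have tau0 j : 0 <= tau Y (fl j)%:R by exact: tau_ge0.
have mG j : measurable (G j) by exact: measurable_count_above_ge.
pose x : 'rV[R]_m := \row_j (5^-1 * tau Y (fl j)%:R).
have x0 j : 0 <= x 0 j by rewrite mxE mulr_ge0.
have := norm_mask_expectation P fnorm fmono mG x0.
have hle : (10^-1 * f tau') <= f (\row_j (fine (P (G j)) * x 0 j)).
  rewrite -normZ//; apply: fmono => j; first by rewrite !mxE mulr_ge0//; exact: tau0.
  rewrite !mxE mulrA; have [->|tneq0] := eqVneq (tau Y (fl j)%:R) 0.
    by rewrite !mulr0.
  have tgt0 : 0 < tau Y (fl j)%:R by rewrite lt_neqAle eq_sym tneq0 tau0.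
  have vlt : v (fl j) < tau Y (fl j)%:R by rewrite /v; lra.
  have v0 : 0 <= v (fl j) by rewrite /v; lra.
  have [_ flm] := flP j.
  have flm' : (fl j)%:R <= m%:R :> R by rewrite ler_nat.
  have := count_above_ge_half (POS_gt0 (flP j))
    (mean_above_lt_tau (fl0 j) flm' v0 vlt).
  rewrite -/(G j) => Ghalf; apply: ler_wpM2r; first exact: tau0.
  by move: Ghalf; set p := fine _; lra.
move=> h; have {h} : ((10^-1 * f tau')%:E <= 'E_P[fun w => f (rvec Y w)])%E.
  apply: (@le_trans _ _ (f (\row_j (fine (P (G j)) * x 0 j)))%:E).
    by rewrite lee_fin.
  apply: (le_trans h); apply: ge0_expectation_le => w.
    by apply: norm_ge0 => // j; rewrite !mxE; case: ifP => // _; rewrite mulr_ge0.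
  have -> : \row_j (if w \in G j then x 0 j else 0) =
      4^-1 *: \row_j (if w \in G j then expansion m v 0 j else 0) :> 'rV[R]_m.
    apply/rowP => j; rewrite !mxE; case: ifP => _; last by rewrite mulr0.
    by rewrite /v -/(fl j); field.
  rewrite normZ// ler_pdivrMl//.
  apply: (@masked_expansion_le_norm _ _ _ fnorm fmono fsym (fun j => w \in G j)).
  - move=> l Pl; rewrite mulr_ge0// tau_ge0//; last by rewrite ltr0n (POS_gt0 Pl).
  - exact: rvec_ge0.
  - by move=> j; rewrite inE /G /= -count_above_nabove.
move=> h; rewrite (_ : f tau' = 10 * (10^-1 * f tau')); last by field.
by rewrite EFinM lee_wpmul2l.
Qed.

Lemma sum_excess_le theta : 0 <= theta -> mean_above Y theta <= 1 ->
  (\sum_(i < m) 'E_P[fun w => (Num.max (Y i w - theta) 0)%R] <=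
    2%:E * 'E_P[fun w => f (rvec Y w)])%E.
Proof.
move=> theta0 mean1.
pose X i w : R := Num.max (Y i w - theta) 0.
pose B j : set T := Y j @^-1` `]theta, +oo[.
pose S w := \sum_i X i w.
pose D w := \sum_i \sum_j (j != i)%:R * (X i w * \1_(B j) w).
pose g w := Num.max (S w - 2^-1 * D w) 0.
have X0 i w : 0 <= X i w by rewrite le_max lexx orbT.
have mX i : measurable_fun setT (X i).
  by apply: measurable_maxr => //; exact: measurable_funB.
have mB j : measurable (B j) by exact: measurable_above.
have mXB i j : measurable_fun setT (fun w => X i w * \1_(B j) w).
  by apply: measurable_funM => //; exact/measurable_indic.
have mcXB i j : measurable_fun setT (fun w => (j != i)%:R * (X i w * \1_(B j) w)).
  exact: measurable_funM.
have S0 w : 0 <= S w by exact: sumr_ge0.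
have D0 w : 0 <= D w.
  by do 2 (apply: sumr_ge0 => ? _); rewrite !mulr_ge0.
have mS : measurable_fun setT S by exact: measurable_sum.
have mD : measurable_fun setT D.
  by apply: measurable_sum => i; exact: measurable_sum.
have mg : measurable_fun setT g.
  by apply: measurable_maxr => //; apply: measurable_funB => //; exact: measurable_funM.
have XB i w : X i w * \1_(B i) w = X i w.
  rewrite /X indicE; case: (boolP (w \in _)) => [_|]; first by rewrite mulr1.
  rewrite notin_setE /B /= in_itv/= andbT => /negP; rewrite -leNgt => Yt.
  by rewrite mulr0 max_r// subr_le0.
(* If n coordinates exceed theta, then S - D / 2 = (3 - n) S / 2, where
   S <= n max_i X_i. *)
have gf w : g w <= f (rvec Y w).
  have Yf i : Y i w <= f (rvec Y w).
    have := coord_le_norm fnorm fnormalized fmono fsym i (rvec_ge0 w).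
    by rewrite mxE.
  have f0 : 0 <= f (rvec Y w) by exact: norm_ge0.
  pose n := count_above Y theta w.
  have nE : n%:R = \sum_j \1_(B j) w :> R by rewrite /n count_aboveE.
  have DE : D w = S w * n%:R - S w.
    rewrite nE /D /S big_distrlr /= -sumrB; apply: eq_bigr => i _.
    rewrite [X in _ = X - _](bigD1 i)//= XB [X in _ = X - _]addrC addrK.
    rewrite (bigD1 i)//= eqxx mul0r add0r; apply: eq_bigr => j ji.
    by rewrite ji mul1r.
  have Sn : S w <= n%:R * f (rvec Y w).
    rewrite nE mulr_suml; apply: ler_sum => i _.
    rewrite -XB mulrC ler_wpM2l// ge_max f0 andbT.
    by rewrite (le_trans _ (Yf i))// gerBl.
  rewrite /g ge_max f0 andbT DE.
  move: Sn (S0 w); set s := S w; set F := f _ in f0 *.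
  case: n {nE DE} => [|[|[|n]]]; rewrite ?mulr0n; try lra.
  rewrite -addn3 natrD => _ s0.
  have : 0 <= s * n%:R by rewrite mulr_ge0.
  by move: f0; rewrite [s * (_ + _)]mulrDr; set q := s * n%:R; lra.
have EXB i j : j != i -> ('E_P[fun w => (X i w * \1_(B j) w)%R] =
    (fine (ccdf (Y j) theta))%:E * 'E_P[X i])%E.
  move=> ji; rewrite ccdf_fineK.
  have mh : measurable_fun setT (fun y : R => Num.max (y - theta) 0).
    by apply: measurable_maxr => //; exact: measurable_funB.
  apply: (@expectation_comp_mul_indic _ _ _ P (Y i) (Y j) _ `]theta, +oo[ _ mh) => //.
    by move=> y; rewrite le_max lexx orbT.
  by move=> A mA; apply: independent_pair => //; rewrite eq_sym.
have EX0 i : (0 <= 'E_P[X i])%E by exact: expectation_ge0.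
have ED : ('E_P[D] <= \sum_i 'E_P[X i])%E.
  rewrite ge0_expectation_sum; first last.
  - by move=> i; exact: measurable_sum.
  - by move=> i w; apply: sumr_ge0 => j _; rewrite !mulr_ge0.
  apply: lee_sum => i _; rewrite ge0_expectation_sum//; last first.
    by move=> j w; rewrite !mulr_ge0.
  apply: (@le_trans _ _ (\sum_j (fine (ccdf (Y j) theta))%:E * 'E_P[X i])%E).
    apply: lee_sum => j _; rewrite ge0_expectationZl//; last first.
      by move=> w; rewrite mulr_ge0.
    have [_|ji] := eqVneq j i; last by rewrite mul1e EXB.
    by rewrite mul0e mule_ge0// lee_fin ccdf_fine_ge0.
  rewrite -ge0_sume_distrl; last by move=> j _; rewrite lee_fin ccdf_fine_ge0.
  rewrite sumEFin -[leRHS]mul1e lee_wpmul2r//.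
have ES : ('E_P[S] = \sum_i 'E_P[X i])%E by rewrite ge0_expectation_sum.
have key : ('E_P[S] <= 'E_P[fun w => f (rvec Y w)] + (2^-1)%:E * 'E_P[S])%E.
  apply: (@le_trans _ _ ('E_P[fun w => (g w + 2^-1 * D w)%R])%E).
    apply: ge0_expectation_le => // w.
    by rewrite -lerBlDr /g le_max lexx.
  have g0 w : 0 <= g w by rewrite le_max lexx orbT.
  rewrite ge0_expectationD//; first last.
  - exact: measurable_funM.
  - by move=> w; rewrite mulr_ge0.
  rewrite leeD//; first by apply: ge0_expectation_le.
  by rewrite ge0_expectationZl// lee_wpmul2l// ES.
rewrite -[leLHS]ES.
have [F_fin|] := boolP ('E_P[fun w => f (rvec Y w)] \is a fin_num)%E; last first.
  rewrite ge0_fin_numE ?expectation_ge0// => [|w]; last exact: norm_ge0.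
  rewrite -leNgt leye_eq => /eqP ->.
  by rewrite gt0_muley ?leey// lte_fin.
have S_fin : 'E_P[S]%E \is a fin_num.
  rewrite ES; apply/sum_fin_numP => i _ _.
  rewrite ge0_fin_numE// (le_lt_trans _ (_ : 'E_P[fun w => f (rvec Y w)] < +oo)%E)//.
    apply: ge0_expectation_le => // w.
    apply: le_trans (coord_le_norm fnorm fnormalized fmono fsym i (rvec_ge0 w)).
    by rewrite mxE ge_max Yge0 andbT gerBl.
  by rewrite ltey_eq F_fin.
move: key; rewrite -(fineK F_fin) -(fineK S_fin) -!EFinM -EFinD !lee_fin; lra.
Qed.

Lemma excess_norm_expansion_le kappa : 0 <= kappa ->
  (forall l, POS m l -> tau Y l%:R <= t l /\ t l <= 2 * tau Y l%:R + kappa) ->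
  (\sum_(i < m) 'E_P[fun w => (Num.max (Y i w - t 1%N) 0)%R]
     + (f (expansion m t))%:E <=
    32%:E * 'E_P[fun w => f (rvec Y w)] + (m%:R * kappa)%:E)%E.
Proof.
move=> kappa0 tauP.
have tau0 l : POS m l -> 0 <= tau Y l%:R.
  by move=> Pl; rewrite tau_ge0// ltr0n (POS_gt0 Pl).
have tau10 : 0 <= tau Y 1 by exact: (tau0 _ POS1).
have Sle : (\sum_(i < m) 'E_P[fun w => (Num.max (Y i w - t 1%N) 0)%R] <=
    2%:E * 'E_P[fun w => f (rvec Y w)])%E.
  apply: le_trans (sum_excess_le tau10 (mean_above_tau Y ltr01)).
  apply: lee_sum => i _; apply: ge0_expectation_le => w.
    by rewrite le_max lexx orbT.
  have [t1 _] := tauP _ POS1.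
  by rewrite ge_max !le_max lexx orbT andbT lerB.
set tau' := expansion m (fun l => tau Y l%:R).
have fle : f (expansion m t) <= 2 * f tau' + m%:R * kappa.
  have [fD _ _] := fnorm.
  apply: (@le_trans _ _ (f (2 *: tau' + const_mx kappa))).
    apply: fmono => i; rewrite !mxE; first by rewrite tge0//; exact: POS_floor_pow2.
    by case: (tauP _ (POS_floor_pow2 i)).
  rewrite (le_trans (fD _ _))// normZ// lerD2l.
  rewrite (le_trans (norm_le_sum fnorm fnormalized fmono fsym _))// => [i|].
    by rewrite mxE.
  under eq_bigr do rewrite mxE.
  by rewrite sumr_const card_ord mulr_natl.
have tle := norm_expansion_tau_le.
have F0 : (0 <= 'E_P[fun w => f (rvec Y w)])%E.
  by apply: expectation_ge0 => w; exact: norm_ge0.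
apply: (@le_trans _ _ (2%:E * 'E_P[fun w => f (rvec Y w)]
    + (2%:E * (10%:E * 'E_P[fun w => f (rvec Y w)]) + (m%:R * kappa)%:E))%E).
  rewrite leeD//; apply: (@le_trans _ _ (2 * f tau' + m%:R * kappa)%:E).
    by rewrite lee_fin.
  by rewrite EFinD EFinM leeD2r// lee_wpmul2l.
rewrite addeA leeD2r// muleA -EFinM -ge0_muleDl ?lee_fin//.
by rewrite lee_wpmul2r// -EFinD lee_fin; lra.
Qed.

End NormOfIndependentVector.

Theorem theorem5p10 (d : measure_display) (T : measurableType d)
  (R : realType) (P : probability T R) (m : nat)
  (Y : 'I_m -> {RV P >-> R})
  (Yindep : mutually_independent Y)
  (Yge0 : forall i w, 0 <= Y i w)
  (f : 'rV[R]_m -> R)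
  (fnorm : is_norm f) (fnormalized : normalized f)
  (fmono : monotone_on_nonneg f) (fsym : symmetric_on_nonneg f)
  (t : nat -> R)
  (tge0 : forall l, POS m l -> 0 <= t l)
  (tnonincr : forall k l, POS m k -> POS m l -> (k <= l)%N -> t l <= t k) :
  (forall alpha beta : R, 1 <= alpha -> 1 <= beta ->
    (forall l, POS m l -> tau Y (beta * l%:R) <= alpha * t l) ->
    ('E_P[fun w => f (rvec Y w)] <=
      (2 * 7 * (alpha + 2) * beta)%:E *
        (\sum_(i < m) 'E_P[fun w => (Num.max (Y i w - alpha * t 1%N) 0)%R]
         + (f (expansion m t))%:E))%E)
  /\
  (forall kappa : R, 0 <= kappa ->
    (forall l, POS m l ->
      tau Y l%:R <= t l /\ t l <= 2 * tau Y l%:R + kappa) ->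
    (\sum_(i < m) 'E_P[fun w => (Num.max (Y i w - t 1%N) 0)%R]
       + (f (expansion m t))%:E <=
      32%:E * 'E_P[fun w => f (rvec Y w)] + (m%:R * kappa)%:E)%E).
Proof.
split; last first.
  by move=> kappa; exact: excess_norm_expansion_le.
move=> alpha beta alpha1 beta1 tau_le.
have F0 : 0 <= f (expansion m t).
  by apply: norm_ge0 => // i; rewrite mxE tge0//; exact: POS_floor_pow2.
apply: (le_trans (expectation_norm_le Yindep Yge0 fnorm fnormalized fmono fsym
  tge0 alpha1 beta1 tau_le)).
have S0 : (0 <= \sum_(i < m) 'E_P[fun w => (Num.max (Y i w - alpha * t 1%N) 0)%R])%E.
  apply: sume_ge0 => i _; apply: expectation_ge0 => w.
  by rewrite le_max lexx orbT.
have ab : 1 <= alpha * beta by rewrite -[1]mulr1 ler_pM.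
rewrite ge0_muleDr ?lee_fin//; apply: leeD.
  by rewrite -[leLHS]mul1e lee_wpmul2r// lee_fin; lra.
by rewrite -EFinM lee_fin ler_wpM2r//; lra.
Qed.
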